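(* Let $Z=\{Z_t\}_{t=0,1,2,\dots}$ be a Parisian walk with respect to the filtration $\mathbf{F}=\{\mathcal{F}_t\}$, let $\{L_t\}$ be its local time, and let $\Vert\cdot\Vert$ be the graph distance from $P=\{0,1,1+\zeta\}$ in $\mathbb{Z}[\zeta]$. Then the process $\{\Vert Z_t\Vert - L_t\}_{t\ge 0}$ is a simple walk.
   Context: Let $\zeta=(-1+\sqrt{-3})/2$ and $\mathbb{Z}[\zeta]=\{a+b\zeta : a,b\in\mathbb{Z}\}\subset\mathbb{C}$. Let $\tau_1,\tau_2,\dots$ be an i.i.d. sequence with $\mathsf{P}(\tau_i=1)=\mathsf{P}(\tau_i=\zeta)=\mathsf{P}(\tau_i=\zeta^2)=1/3$, and let $\mathbf{F}=\{\mathcal{F}_t\}_{t\ge 0}$ be the filtration it generates: $\mathcal{F}_t=\sigma(\tau_1,\dots,\tau_t)$, with $\mathcal{F}_0$ trivial. Parisian walk: an $\mathbf{F}$-adapted complex valued process $\{Z_t\}_{t\ge 0}$ such that (i) it is an $\mathbf{F}$-martingale starting from a point of $\mathbb{Z}[\zeta]$, and (ii) $Z_{t+1}-Z_t\in\{1,\zeta,\zeta^2\}$ for all $t$. Simple walk: an $\mathbf{F}$-martingale $\{X_t\}_{t\ge0}$ with $X_0\in\mathbb{Z}$ and such that, for each $t\ge 1$, $X_t-X_{t-1}$ takes each of the values $1,0,-1$ with probability $1/3$. Graph distance: $\mathbb{Z}[\zeta]$ is regarded as the (undirected) triangular lattice graph in which $z$ and $w$ are adjacent iff $z-w\in\{\pm1,\pm\zeta,\pm\zeta^2\}$.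 Let $P=\{0,1,1+\zeta\}$. For $z\in\mathbb{Z}[\zeta]$, $\Vert z\Vert$ is the length of the shortest path from $P$ to $z$ in this graph (so $\Vert z\Vert=0$ for $z\in P$). Regions ($k_1,k_2$ range over integers): $A_1=\{k_1+k_2\zeta^2 : 1<k_2+1<k_1\}$, $A_3=\{-k_1-k_2\zeta : 0<k_2<k_1\}$, $A_5=\{-k_1\zeta^2-k_2 : 1<k_2+1<k_1\}$; $B_1=\{k : k\ge 2\}$, $B_2=\{k\zeta-\zeta^2 : k\ge1\}$, $B_3=\{k\zeta^2 : k\ge 1\}$, $B_4=\{k : k\le -1\}$, $B_5=\{1+k\zeta : k\le -1\}$, $B_6=\{k\zeta^2 : k\le -2\}$ (with $k$ an integer). Closures: $\bar A_1=A_1\cup B_1\cup B_5\cup\{1\}$, $\bar A_3=A_3\cup B_3\cup B_4\cup\{0\}$, $\bar A_5=A_5\cup B_2\cup B_6\cup\{1+\zeta\}$. Local time: for $j=1,3,5$ let $l^j_t=\#\{u\in\mathbb{Z}_{\ge0} : u<t,\ Z_u\in\bar A_j,\ Z_{u+1}\notin\bar A_j\}$, and $L_t=l^1_t+l^3_t+l^5_t$. *)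

(* Defs.v *)
From mathcomp Require Import all_boot all_order all_algebra.
From mathcomp Require Import finmap complex.
From mathcomp Require Import all_classical all_reals all_analysis.

Set Implicit Arguments.
Unset Strict Implicit.
Unset Printing Implicit Defensive.

Import Order.TTheory GRing.Theory Num.Theory.
Import numFieldNormedType.Exports.

Local Open Scope classical_set_scope.
Local Open Scope ring_scope.

Section Lattice.
Variable R : realType.
Implicit Types z w : R[i].

Definition zeta : R[i] := (-1 + ('i * (Num.sqrt 3%:R)%:C)%C) / 2%:R.

Definition eisenstein : set R[i] :=
  [set z | exists a b : int, z = a%:~R + b%:~R * zeta].

Definition lattice_adj : rel R[i] := fun z w =>
  [&& z \in eisenstein, w \in eisenstein &
      z - w \in [:: 1; -1; zeta; - zeta; zeta ^+ 2; - zeta ^+ 2]].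

Definition Pset : set R[i] := [set 0; 1; 1 + zeta].

Definition joined_to_P (n : nat) z : Prop :=
  exists (x : R[i]) (p : seq R[i]),
    [/\ Pset x, path lattice_adj x p, last x p = z & size p = n].

(* Only meaningful on [eisenstein]; its value is 0 elsewhere. *)
Definition Pdist z : nat :=
  xget 0%N [set n | joined_to_P n z /\
                    forall m, joined_to_P m z -> (n <= m)%N].

Definition A1 : set R[i] := [set z | exists k1 k2 : int,
  z = k1%:~R + k2%:~R * zeta ^+ 2 /\ 1 < k2 + 1 < k1].
Definition A3 : set R[i] := [set z | exists k1 k2 : int,
  z = - k1%:~R - k2%:~R * zeta /\ 0 < k2 < k1].
Definition A5 : set R[i] := [set z | exists k1 k2 : int,
  z = - k1%:~R * zeta ^+ 2 - k2%:~R /\ 1 < k2 + 1 < k1].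

Definition B1 : set R[i] := [set z | exists k : int,
  z = k%:~R /\ 2 <= k].
Definition B2 : set R[i] := [set z | exists k : int,
  z = k%:~R * zeta - zeta ^+ 2 /\ 1 <= k].
Definition B3 : set R[i] := [set z | exists k : int,
  z = k%:~R * zeta ^+ 2 /\ 1 <= k].
Definition B4 : set R[i] := [set z | exists k : int,
  z = k%:~R /\ k <= -1].
Definition B5 : set R[i] := [set z | exists k : int,
  z = 1 + k%:~R * zeta /\ k <= -1].
Definition B6 : set R[i] := [set z | exists k : int,
  z = k%:~R * zeta ^+ 2 /\ k <= -2].

Definition barA1 : set R[i] := A1 `|` B1 `|` B5 `|` [set 1].
Definition barA3 : set R[i] := A3 `|` B3 `|` B4 `|` [set 0].
Definition barA5 : set R[i] := A5 `|` B2 `|` B6 `|` [set 1 + zeta].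

Definition exits (A : set R[i]) (z : nat -> R[i]) (t : nat) : nat :=
  #|[pred u : 'I_t | (z u \in A) && (z u.+1 \notin A)]|.

Definition local_time (z : nat -> R[i]) (t : nat) : nat :=
  (exits barA1 z t + exits barA3 z t + exits barA5 z t)%N.

(* The Borel structure of the complex plane is that of [R * R]. *)
Definition ReIm z : R * R := (complex.Re z, complex.Im z).

End Lattice.

Arguments zeta {R}.

Section Processes.
Context {R : realType} {d : measure_display} {T : measurableType d}.
Variable P : probability T R.

(* [tau k] is the step performed between times [k] and [k.+1], i.e. the
   sequence tau_1, tau_2, ... is indexed from 0. *)
Definition iid_steps (tau : nat -> T -> R[i]) : Prop :=
  [/\ forall k, measurable_fun setT (@ReIm R \o tau k),
      forall (J : {fset nat}) (B : nat -> set (R * R)),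
        (forall k, measurable (B k)) ->
        P (\bigcap_(k in [set` J]) ((@ReIm R \o tau k) @^-1` B k)) =
        (\prod_(k <- J) P ((@ReIm R \o tau k) @^-1` B k))%E &
      forall k, [/\ P [set x | tau k x = 1] = (3%:R^-1)%:E,
                    P [set x | tau k x = zeta] = (3%:R^-1)%:E &
                    P [set x | tau k x = zeta ^+ 2] = (3%:R^-1)%:E]].

Definition filtration_of (tau : nat -> T -> R[i]) (t : nat) : set (set T) :=
  <<s \bigcup_(k in `I_t)
        preimage_set_system setT (@ReIm R \o tau k) measurable >>.

Definition adapted {d'} {E : measurableType d'} (F : nat -> set (set T))
    (X : nat -> T -> E) : Prop :=
  forall t (B : set E), measurable B -> F t (X t @^-1` B).

(* [Y] is a version of the conditional expectation of [X] given the
   sub-sigma-algebra [G]. *)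
Definition is_cond_expectation (G : set (set T)) (X Y : T -> R) : Prop :=
  [/\ forall B : set R, measurable B -> G (Y @^-1` B),
      P.-integrable setT (EFin \o Y) &
      forall A, G A ->
        (\int[P]_(x in A) (Y x)%:E = \int[P]_(x in A) (X x)%:E)%E].

Definition martingale (F : nat -> set (set T)) (X : nat -> T -> R) : Prop :=
  [/\ adapted F X,
      forall t, P.-integrable setT (EFin \o X t) &
      forall t, is_cond_expectation (F t) (X t.+1) (X t)].

Definition complex_martingale (F : nat -> set (set T))
    (Z : nat -> T -> R[i]) : Prop :=
  martingale F (fun t x => complex.Re (Z t x)) /\
  martingale F (fun t x => complex.Im (Z t x)).

Definition parisian_walk (F : nat -> set (set T))
    (Z : nat -> T -> R[i]) : Prop :=
  [/\ adapted F (fun t x => ReIm (Z t x)),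
      complex_martingale F Z,
      exists2 z0, eisenstein z0 & forall x, Z 0%N x = z0 &
      forall t x, Z t.+1 x - Z t x \in [:: 1; zeta; zeta ^+ 2]].

Definition simple_walk (F : nat -> set (set T)) (X : nat -> T -> R) : Prop :=
  [/\ martingale F X,
      exists k : int, forall x, X 0%N x = k%:~R &
      forall t, [/\ P [set x | X t.+1 x - X t x = 1] = (3%:R^-1)%:E,
                    P [set x | X t.+1 x - X t x = 0] = (3%:R^-1)%:E &
                    P [set x | X t.+1 x - X t x = -1] = (3%:R^-1)%:E]].

End Processes.

(* Main.v *)
Require Import Defs.
From mathcomp Require Import all_boot all_order all_algebra.
From mathcomp Require Import finmap complex.
From mathcomp Require Import all_classical all_reals all_analysis.
From mathcomp Require Import zify ring lra.

Set Implicit Arguments.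
Unset Strict Implicit.
Unset Printing Implicit Defensive.

Import Order.TTheory GRing.Theory Num.Theory.
Import numFieldNormedType.Exports.
Local Open Scope classical_set_scope.
Local Open Scope ring_scope.

(* In the coordinates [(a, b)] of [a + b zeta], the distance to [P] is a maximum
   of six linear forms, one for each of the three sets [barA_j] and of the three
   sectors between them. On each of these six regions the increment of
   [Pdist Z - L] is a function of the step of [Z] alone, and this function is a
   bijection from the three steps onto [{1, 0, -1}].
   Since [1], [zeta], [zeta ^+ 2] are affinely independent over the reals, the
   martingale property of [Z] forces its step to be uniform conditionally on
   [F t], hence so is the increment of [Pdist Z - L]. *)

(** * Distance and increments in integer coordinates *)

Definition hexdist (w : int * int) : int :=
  Num.max (Num.max (w.1 - 1) (w.2 - 1))
    (Num.max (Num.max (- w.1) (- w.2)) (Num.max (w.1 - 1 - w.2) (w.2 - w.1))).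

(** Closed sectors of 60 degrees whose apexes [1], [0] and [1 + zeta] are the points of [Pset]. *)
Definition in_barA1 (w : int * int) := (1 <= w.1) && (w.2 <= 0).
Definition in_barA3 (w : int * int) := (w.1 <= w.2) && (w.2 <= 0).
Definition in_barA5 (w : int * int) := (1 <= w.1) && (w.1 <= w.2).

Definition exits_at (A : pred (int * int)) (w s : int * int) : nat :=
  A w && ~~ A (w + s).

Definition walk_incr (w s : int * int) : int :=
  hexdist (w + s) - hexdist w -
  (exits_at in_barA1 w s + exits_at in_barA3 w s + exits_at in_barA5 w s)%N%:Z.

(* The coordinates of [1], [zeta] and [zeta ^+ 2]. *)
Definition steps : seq (int * int) := [:: (1, 0); (0, 1); (-1, -1)].

(** On each region the distance is one linear form, with values 1, 0, -1 on the three steps in some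
    order. The forms of the sectors between the [barA_j] remain correct one step past their border;
    the form of a [barA_j] is one too small exactly when the step leaves it, and the local time
    takes off this unit. *)
Lemma walk_incr_perm w :
  perm_eq [seq walk_incr w s | s <- steps] [:: 1; 0; -1].
Proof.
case: w => a b.
suff [x [y [z [e1 e2 e3]]]] : exists x y z, [/\ walk_incr (a, b) (1, 0) = x,
    walk_incr (a, b) (0, 1) = y, walk_incr (a, b) (-1, -1) = z &
    perm_eq [:: x; y; z] [:: 1; 0; -1]] by rewrite /= e1 e2 e3.
rewrite /walk_incr /exits_at /in_barA1 /in_barA3 /in_barA5 /hexdist /=.
(* The patterns [1 <= a <= b <= 0] and [0 < b < a < 1] are empty. The others are, in order, [barA1],
   [barA3], [b < a <= 0], [barA5], [0 < b < a] and [a <= 0 < b], with distances [a - 1 - b], [- a],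
   [- b], [b - 1], [a - 1] and [b - a]. *)
have [hb|hb] := lerP b 0; have [h1|h1] := lerP 1 a;
  have [hab|hab] := lerP a b; try (exfalso; lia).
- by exists 1, (-1), 0; split => //; lia.
- by exists (-1), 0, 1; split => //; lia.
- by exists 0, (-1), 1; split => //; lia.
- by exists 0, 1, (-1); split => //; lia.
- by exists 1, 0, (-1); split => //; lia.
- by exists (-1), 1, 0; split => //; lia.
Qed.

(** Both orientations of each step, since the graph is undirected, in the order of the list in
    [lattice_adj]. *)
Definition lattice_dirs : seq (int * int) :=
  [:: (1, 0); (-1, 0); (0, 1); (0, -1); (-1, -1); (1, 1)].

Lemma lattice_dirsN s : s \in lattice_dirs -> - s \in lattice_dirs.
Proof. by rewrite /lattice_dirs !inE; do ?[case/orP]; move=> /eqP->. Qed.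

(** Each of the six forms grows by at most 1 along an edge; this bounds path lengths from below. *)
Lemma hexdist_step w s :
  s \in lattice_dirs -> hexdist (w + s) <= hexdist w + 1.
Proof.
case: w => a b; rewrite /lattice_dirs !inE.
by do ?[case/orP]; move=> /eqP->; rewrite /hexdist /=; lia.
Qed.

Lemma hexdist_ge0 w : 0 <= hexdist w.
Proof. by rewrite /hexdist; lia. Qed.

Lemma hexdist_eq0 w : hexdist w = 0 -> w \in [:: (0, 0); (1, 0); (1, 1)].
Proof. by case: w => a b; rewrite !inE /eq_op /= /hexdist /=; lia. Qed.

(** Source of the upper bound on the graph distance: repeated descent reaches [Pset] in [hexdist w]
    edges. *)
Lemma hexdist_descent w : 0 < hexdist w ->
  exists2 s, s \in lattice_dirs & hexdist (w - s) = hexdist w - 1.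
Proof.
case: w => a b; rewrite {1}/hexdist /= => h.
have [hb|hb] := lerP b 0; have [h1|h1] := lerP 1 a;
  have [hab|hab] := lerP a b; try (exfalso; lia).
(* Crossing the side [b = 0] leaves the distance unchanged, so there the descent follows the side
   towards the apex. *)
- have [hb0|hb0] := ltrP b 0;
    [exists (0, -1)|exists (1, 0)] => //; rewrite /hexdist /=; lia.
- have [hb0|hb0] := ltrP b 0;
    [exists (-1, -1)|exists (-1, 0)] => //; rewrite /hexdist /=; lia.
- by exists (0, -1) => //; rewrite /hexdist /=; lia.
- have [hb0|hb0] := ltrP a b;
    [exists (0, 1)|exists (1, 1)] => //; rewrite /hexdist /=; lia.
- by exists (1, 0) => //; rewrite /hexdist /=; lia.
- by exists (-1, 0) => //; rewrite /hexdist /=; lia.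
Qed.

(** * Transfer between the complex lattice and integer coordinates *)

Section Coordinates.
Variable R : realType.

Definition eis (w : int * int) : R[i] := w.1%:~R + w.2%:~R * zeta.

Lemma eisD w s : eis (w + s) = eis w + eis s.
Proof. by rewrite /eis /= !rmorphD /=; ring. Qed.

Lemma eisN w : eis (- w) = - eis w.
Proof. by rewrite /eis /= !rmorphN /=; ring. Qed.

Lemma imaginaryE : 'i = 'i%C :> R[i].
Proof.
by rewrite [LHS]complexE complexRe complexIm Re_i Im_i add0r mulr1.
Qed.

Lemma zeta2E : zeta ^+ 2 = - 1 - zeta :> R[i].
Proof.
have s3 : ((Num.sqrt 3%:R : R)%:C%C) ^+ 2 = 3 :> R[i].
  by rewrite -rmorphXn /= sqr_sqrtr ?ler0n// rmorph_nat.
rewrite /zeta; set s := (_%:C)%C in s3 *.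
apply/eqP; rewrite -subr_eq0; apply/eqP.
transitivity (('i ^+ 2 * s ^+ 2 + 3) / 4 : R[i]); first by field.
by rewrite s3 sqrCi; field.
Qed.

Lemma eisE w : eis w =
  ((w.1%:~R - w.2%:~R / 2) +i* (w.2%:~R * (Num.sqrt 3 / 2)))%C.
Proof.
rewrite [RHS]complexE /= /eis /zeta imaginaryE.
rewrite !(rmorphB, rmorphM, rmorph_int, fmorphV, rmorph_nat) /=.
by field.
Qed.

Lemma eis_inj : injective eis.
Proof.
move=> [a b] [c d]; rewrite !eisE /= => -[h1].
move=> /(mulIf _) h2; have {h2} : b%:~R = d%:~R :> R.
  by apply: h2; rewrite mulf_neq0// ?invr_eq0 ?pnatr_eq0// gt_eqF//
    sqrtr_gt0 ltr0n.
move=> /intr_inj bd; move: h1; rewrite bd => /addIr /intr_inj ->//.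
Qed.

Lemma eisP z : eisenstein z -> exists w, z = eis w.
Proof. by move=> [a [b ->]]; exists (a, b). Qed.

Lemma eis_eisenstein w : eisenstein (eis w).
Proof. by exists w.1, w.2. Qed.

Lemma lattice_adjE w w' :
  lattice_adj (eis w) (eis w') = (w - w' \in lattice_dirs).
Proof.
rewrite /lattice_adj !mem_set/=; try exact: eis_eisenstein.
rewrite -eisN -eisD -(mem_map eis_inj) /=.
by rewrite zeta2E /eis /=; congr (_ \in [:: _; _; _; _; _; _]); ring.
Qed.

Lemma Pset_hexdist0 w : Pset (eis w) -> hexdist w = 0.
Proof.
have e0 : 0 = eis (0, 0) by rewrite /eis /=; ring.
have e1 : 1 = eis (1, 0) by rewrite /eis /=; ring.
have e2 : 1 + zeta = eis (1, 1) by rewrite /eis /=; ring.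
by rewrite /Pset e2 e1 e0 => -[[]|] /= /eis_inj->.
Qed.

Lemma hexdist0_Pset w : hexdist w = 0 -> Pset (eis w).
Proof.
move=> /hexdist_eq0; rewrite !inE => /or3P[] /eqP->.
- by left; left; rewrite /= /eis /=; ring.
- by left; right; rewrite /= /eis /=; ring.
- by right; rewrite /= /eis /=; ring.
Qed.

Lemma path_hexdist p w w' :
  path (@lattice_adj R) (eis w) p -> last (eis w) p = eis w' ->
  hexdist w' <= hexdist w + (size p)%:Z.
Proof.
elim: p w => [|z p IH] w /=; first by move=> _ /eis_inj ->; lia.
(* Adjacency includes membership in [eisenstein], which supplies coordinates for the next vertex. *)
case/andP => adj; have [_ /set_mem/eisP[v zE] _] := and3P adj.
rewrite {}zE in adj *; rewrite lattice_adjE in adj => pp lp.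
have := IH _ pp lp; have := @hexdist_step w (v - w).
have -> : v - w \in lattice_dirs by rewrite -opprB lattice_dirsN.
by rewrite addrC subrK => /(_ isT); lia.
Qed.

(** The path is built from its far end: a path to a neighbour one unit closer is extended by
    [eis w]. *)
Lemma joined_hexdist w : joined_to_P `|hexdist w|%N (eis w).
Proof.
move: {2}`|hexdist w|%N (erefl `|hexdist w|%N) => n.
elim: n w => [|n IH] w wn.
  by exists (eis w), [::]; split => //; apply: hexdist0_Pset; lia.
have [s sdir ds] :
    exists2 s, s \in lattice_dirs & hexdist (w - s) = hexdist w - 1.
  by apply: hexdist_descent; have := hexdist_ge0 w; lia.
have wsn : `|hexdist (w - s)%R|%N = n by have := hexdist_ge0 w; lia.
have [x [p [Px pp lp sp]]] := IH _ wsn.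
exists x, (rcons p (eis w)); split => //.
- rewrite rcons_path pp lp lattice_adjE addrAC subrr add0r.
  exact: lattice_dirsN.
- by rewrite last_rcons.
- by rewrite size_rcons sp wsn wn.
Qed.

Lemma Pdist_eis w : (Pdist (eis w))%:Z = hexdist w.
Proof.
rewrite -[RHS]gez0_abs ?hexdist_ge0//; congr Posz.
have lb m : joined_to_P m (eis w) -> (`|hexdist w| <= m)%N.
  move=> [x [p [Px pp lp <-]]]; have [v xE] : exists v, x = eis v.
    case: p pp lp => [_ /= ->|z p]; first by exists w.
    by move=> /= /andP[/and3P[/set_mem/eisP]].
  rewrite {}xE in Px pp lp; have := path_hexdist pp lp.
  by rewrite (Pset_hexdist0 Px); have := hexdist_ge0 w; lia.
rewrite /Pdist.
(* The default value of [xget] never arises, since [hexdist w] is a minimum. *)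
case: xgetP => [n _ [jn /(_ _ (joined_hexdist w)) nle]|/(_ `|hexdist w|%N)].
  by apply/eqP; rewrite eqn_leq nle lb.
by case; split; [exact: joined_hexdist|exact: lb].
Qed.

(** The pieces are the interior [A1], the sides [B1] and [B5], and the apex, according to which of
    [1 <= w.1] and [w.2 <= 0] is strict. The witnesses come from [zeta ^+ 2 = - 1 - zeta]. The other
    two sectors are treated in the same way. *)
Lemma barA1E w : (eis w \in @barA1 R) = in_barA1 w.
Proof.
rewrite /in_barA1; apply/idP/idP => [/set_mem|/andP[h1 h2]].
  have eq_eis z v : eis w = z -> z = eis v -> w = v by move=> <- /eis_inj.
  case=> [[[]|]|].
  - move=> [k1 [k2 [/eq_eis e ?]]]; rewrite (e (k1 - k2, - k2)) /=; first lia.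
    by rewrite zeta2E /eis /= rmorphB rmorphN /=; ring.
  - move=> [k [/eq_eis e ?]]; rewrite (e (k, 0)) /=; first lia.
    by rewrite /eis /=; ring.
  - move=> [k [/eq_eis e ?]]; rewrite (e (1, k)) /=; first lia.
    by rewrite /eis.
  - by move=> /eq_eis e; rewrite (e (1, 0)) // /eis /=; ring.
apply: mem_set; rewrite /eis.
have [h|h] := ltP 1 w.1; have [h'|h'] := ltP w.2 0.
- left; left; left; exists (w.1 - w.2), (- w.2); split; last lia.
  by rewrite zeta2E rmorphB rmorphN /=; ring.
- left; left; right; exists w.1; split; last lia.
  have -> : w.2 = 0 by lia.
  by rewrite mul0r addr0.
- left; right; exists w.2; split; last lia.
  have -> // : w.1 = 1 by lia.
- have [-> ->] : w.1 = 1 /\ w.2 = 0 by lia.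
  by right; rewrite /= mul0r addr0.
Qed.

Lemma barA3E w : (eis w \in @barA3 R) = in_barA3 w.
Proof.
rewrite /in_barA3; apply/idP/idP => [/set_mem|/andP[h1 h2]].
  have eq_eis z v : eis w = z -> z = eis v -> w = v by move=> <- /eis_inj.
  case=> [[[]|]|].
  - move=> [k1 [k2 [/eq_eis e ?]]]; rewrite (e (- k1, - k2)) /=; first lia.
    by rewrite /eis /= !rmorphN /=; ring.
  - move=> [k [/eq_eis e ?]]; rewrite (e (- k, - k)) /=; first lia.
    by rewrite zeta2E /eis /= rmorphN /=; ring.
  - move=> [k [/eq_eis e ?]]; rewrite (e (k, 0)) /=; first lia.
    by rewrite /eis /=; ring.
  - by move=> /eq_eis e; rewrite (e (0, 0)) // /eis /=; ring.
apply: mem_set; rewrite /eis.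
have [h|h] := ltP w.1 w.2; have [h'|h'] := ltP w.2 0.
- left; left; left; exists (- w.1), (- w.2); split; last lia.
  by rewrite !rmorphN /=; ring.
- left; right; exists w.1; split; last lia.
  have -> : w.2 = 0 by lia.
  by rewrite mul0r addr0.
- left; left; right; exists (- w.1); split; last lia.
  have -> : w.2 = w.1 by lia.
  by rewrite zeta2E rmorphN /=; ring.
- have [-> ->] : w.1 = 0 /\ w.2 = 0 by lia.
  by right; rewrite /= mul0r addr0.
Qed.

Lemma barA5E w : (eis w \in @barA5 R) = in_barA5 w.
Proof.
rewrite /in_barA5; apply/idP/idP => [/set_mem|/andP[h1 h2]].
  have eq_eis z v : eis w = z -> z = eis v -> w = v by move=> <- /eis_inj.
  case=> [[[]|]|].
  - move=> [k1 [k2 [/eq_eis e ?]]]; rewrite (e (k1 - k2, k1)) /=; first lia.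
    by rewrite zeta2E /eis /= rmorphB /=; ring.
  - move=> [k [/eq_eis e ?]]; rewrite (e (1, k + 1)) /=; first lia.
    by rewrite zeta2E /eis /= rmorphD /=; ring.
  - move=> [k [/eq_eis e ?]]; rewrite (e (- k, - k)) /=; first lia.
    by rewrite zeta2E /eis /= rmorphN /=; ring.
  - by move=> /eq_eis e; rewrite (e (1, 1)) // /eis /=; ring.
apply: mem_set; rewrite /eis.
have [h|h] := ltP 1 w.1; have [h'|h'] := ltP w.1 w.2.
- left; left; left; exists w.2, (w.2 - w.1); split; last lia.
  by rewrite zeta2E rmorphB /=; ring.
- left; right; exists (- w.1); split; last lia.
  have -> : w.2 = w.1 by lia.
  by rewrite zeta2E rmorphN /=; ring.
- left; left; right; exists (w.2 - 1); split; last lia.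
  have -> : w.1 = 1 by lia.
  by rewrite zeta2E rmorphB /=; ring.
- have [-> ->] : w.1 = 1 /\ w.2 = 1 by lia.
  by right; rewrite /= mul1r.
Qed.

Lemma exits_recr (A : set R[i]) z t :
  exits A z t.+1 = (exits A z t + ((z t \in A) && (z t.+1 \notin A)))%N.
Proof.
rewrite /exits -!sum1_card big_mkcond big_ord_recr /= -big_mkcond /=.
by congr addn; rewrite inE; case: ifP.
Qed.

(** An exit between [t] and [t.+1] enters [local_time] at [t.+1], so one step changes distance and
    local time together. *)
Lemma walk_incrE z t w s : z t = eis w -> z t.+1 = eis (w + s) ->
  (Pdist (z t.+1))%:Z - (local_time z t.+1)%:Z =
  (Pdist (z t))%:Z - (local_time z t)%:Z + walk_incr w s.
Proof.
move=> zt zt1; rewrite /local_time !exits_recr zt zt1 !Pdist_eis.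
by rewrite !barA1E !barA3E !barA5E /walk_incr /exits_at; lia.
Qed.

End Coordinates.

(** * Countably valued maps and sub-sigma-algebras *)

Section SigmaAlgebra.
Variables (T : Type) (G : set (set T)) (sG : sigma_algebra setT G).

Lemma sigma_algebra_setI A B : G A -> G B -> G (A `&` B).
Proof.
have /sigma_algebraP[|_ _ _ GI] := sG; first by move=> X _.
exact: GI.
Qed.

Lemma sigma_algebra_countable_bigcup (K : countType) (F : K -> set T) :
  (forall k, G (F k)) -> G (\bigcup_k F k).
Proof.
have [G0 _ GU] := sG; move=> GF.
(* The union is reindexed by [nat], with the empty set at numbers that code no element of [K]. *)
rewrite (_ : \bigcup_k F k =
    \bigcup_(n in [set: nat]) oapp F set0 (choice.unpickle n)).
  by apply: GU => n; case: choice.unpickle.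
apply/seteqP; split => [x [k _ Fx]|x [n _]].
  by exists (choice.pickle k) => //; rewrite choice.pickleK.
by case: choice.unpickle => //= k Fx; exists k.
Qed.

(** Measurability for the discrete sigma-algebra on [K], suited to integer and lattice valued maps:
    any function of such a map is again measurable. [G] is a bare set system so that it can be a
    member of the filtration. *)
Definition discretely_measurable (K : Type) (X : T -> K) :=
  forall B : set K, G (X @^-1` B).

Lemma discretely_measurable_fibers (K : countType) (X : T -> K) :
  (forall k, G (X @^-1` [set k])) -> discretely_measurable X.
Proof.
have [G0 _ _] := sG; move=> GX B.
rewrite (_ : X @^-1` B = \bigcup_k [set x | X x = k /\ B k]).
  apply: sigma_algebra_countable_bigcup => k.
  have [Bk|nBk] := pselect (B k).
    rewrite (_ : [set _ | _] = X @^-1` [set k]) //.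
    by apply/seteqP; split => x //= [].
  by rewrite (_ : [set _ | _] = set0) //; apply/seteqP; split => x //= [].
by apply/seteqP; split => [x Bx|x [k _ [<- //]]]; exists (X x).
Qed.

Lemma discretely_measurable_pair (K L : countType) (X : T -> K) (Y : T -> L) :
  discretely_measurable X -> discretely_measurable Y ->
  discretely_measurable (fun x => (X x, Y x)).
Proof.
move=> GX GY; apply: discretely_measurable_fibers => -[k l].
rewrite (_ : _ @^-1` _ = X @^-1` [set k] `&` Y @^-1` [set l]).
  exact: sigma_algebra_setI.
by apply/seteqP; split => x /= [-> ->].
Qed.

End SigmaAlgebra.

Section Filtration.
Context {R : realType} {d : measure_display} {T : measurableType d}.
Variable tau : nat -> T -> R[i].

Lemma filtration_sigma_algebra t : sigma_algebra setT (filtration_of tau t).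
Proof. exact: smallest_sigma_algebra. Qed.

Lemma filtration_le t : filtration_of tau t `<=` filtration_of tau t.+1.
Proof.
apply: sub_sigma_algebra2 => A [k /= kt Ak].
by exists k => //=; exact: ltnW.
Qed.

Lemma filtration_measurable t :
  (forall k, measurable_fun setT (@ReIm R \o tau k)) ->
  filtration_of tau t `<=` measurable.
Proof.
move=> mtau; apply: smallest_sub; first exact: sigma_algebra_measurable.
by move=> A [k _ [B mB <-]]; exact: mtau.
Qed.

End Filtration.

(** * Integrals of finite combinations of indicators *)

Section Integral.
Context {R : realType} {d : measure_display} {T : measurableType d}.
Variable P : probability T R.

Lemma integrable_simple (I : Type) (s : seq I) (c : I -> R) (D : I -> set T) :
  (forall i, measurable (D i)) ->
  P.-integrable setT (fun x => (\sum_(i <- s) c i * \1_(D i) x)%:E).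
Proof.
move=> mD; under eq_fun do rewrite -sumEFin.
apply: (@integrable_sum _ _ _ P _ _ _ s xpredT
  (fun i x => (c i * \1_(D i) x)%:E)) => // i _.
under eq_fun do rewrite EFinM.
by apply: integrableZl => //; exact: integrable_indic.
Qed.

Lemma integral_simple (I : Type) (s : seq I) (c : I -> R) (D : I -> set T)
    (A : set T) :
  (forall i, measurable (D i)) -> measurable A ->
  (\int[P]_(x in A) (\sum_(i <- s) c i * \1_(D i) x)%:E =
  (\sum_(i <- s) c i * fine (P (A `&` D i)))%:E)%E.
Proof.
move=> mD mA.
have iD i : P.-integrable A (fun x => (\1_(D i) x)%:E).
  by apply: (@integrableS _ _ _ P setT) => //; exact: integrable_indic.
under eq_integral do rewrite -sumEFin.
rewrite (@integral_sum _ _ _ P _ _ _ (fun i x => (c i * \1_(D i) x)%:E)) //.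
  rewrite -sumEFin; apply: eq_bigr => i _.
  under eq_integral do rewrite EFinM.
  rewrite integralZl// integral_indic// EFinM fineK ?fin_num_measure//;
    first by rewrite setIC.
  exact: measurableI.
by move=> i; under eq_fun do rewrite EFinM; apply: integrableZl.
Qed.

(** The indicator identity encodes that, within [A], the [D i] split [B] into disjoint pieces; it is
    integrated over [A]. *)
Lemma fine_measure_partition (I : Type) (s : seq I) (D : I -> set T)
    (A B : set T) :
  (forall i, measurable (D i)) -> measurable A -> measurable B ->
  (forall x, A x -> \1_B x = \sum_(i <- s) \1_(D i) x :> R) ->
  fine (P (A `&` B)) = \sum_(i <- s) fine (P (A `&` D i)).
Proof.
move=> mD mA mB BD.
have := @integral_simple I s (fun=> 1) D A mD mA.
under [X in _ = X%:E -> _]eq_bigr do rewrite mul1r.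
under eq_integral => x /set_mem Ax.
  under eq_bigr do rewrite mul1r.
  rewrite -BD//; over.
by rewrite integral_indic// setIC => ->.
Qed.

Lemma integral_add_simple (I : Type) (s : seq I) (c : I -> R) (D : I -> set T)
    (A : set T) (X Y : T -> R) :
  (forall i, measurable (D i)) -> measurable A ->
  P.-integrable setT (EFin \o X) ->
  (forall x, Y x = X x + \sum_(i <- s) c i * \1_(D i) x) ->
  (\int[P]_(x in A) (Y x)%:E = \int[P]_(x in A) (X x)%:E +
  (\sum_(i <- s) c i * fine (P (A `&` D i)))%:E)%E.
Proof.
move=> mD mA iX YX; under eq_integral do rewrite YX EFinD.
rewrite integralD ?integral_simple//.
  by apply: (@integrableS _ _ _ P setT).
apply: (@integrableS _ _ _ P setT) => //; exact: integrable_simple.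
Qed.

End Integral.

Lemma sum_indic_fibers (R : realType) (T : Type) (K : eqType) (r : seq K)
    (S : T -> K) (c : K -> R) x :
  uniq r -> S x \in r -> \sum_(k <- r) c k * \1_[set y | S y = k] x = c (S x).
Proof.
move=> ur Sr; rewrite (bigD1_seq (S x)) //= indicE mem_set//= mulr1.
rewrite big1 ?addr0//.
by move=> k kS; rewrite indicE memNset ?mulr0//= => e; rewrite e eqxx in kS.
Qed.

(** * Conditional law of the steps and of the increments *)

Section Steps.
Context {R : realType} {d : measure_display} {T : measurableType d}.
Variable P : probability T R.

(** For additive [f] the change of [f (W x)] is [f (S x)], so equal integrals over [A] force the
    integral of [f (S x)] to vanish. *)
Lemma conserved_mean_step (W S : T -> int * int) (f : int * int -> R)
    (A : set T) :
  discretely_measurable (@measurable _ T) S -> (forall x, S x \in steps) ->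
  measurable A -> {morph f : w s / w + s} ->
  P.-integrable setT (fun x => (f (W x))%:E) ->
  (\int[P]_(x in A) (f (W x))%:E = \int[P]_(x in A) (f (W x + S x))%:E)%E ->
  \sum_(s <- steps) f s * fine (P (A `&` [set x | S x = s])) = 0.
Proof.
move=> mS Ssteps mA fD iW.
have mSs s : measurable [set x | S x = s] by exact: (mS [set s]).
rewrite (@integral_add_simple _ _ _ P _ steps f (fun s => [set x | S x = s]) A
  (f \o W) (fun x => f (W x + S x))) //=.
  (* Cancelling the common integral in the extended reals requires it to be finite. *)
  have /fineK <- : (\int[P]_(x in A) (f (W x))%:E)%E \is a fin_num.
    by apply: integrable_fin_num => //; exact: (@integrableS _ _ _ P setT).
  rewrite -EFinD => -[] /eqP.
  by rewrite -subr_eq0 opprD addrA subrr add0r oppr_eq0 => /eqP.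
by move=> x; rewrite sum_indic_fibers// fD.
Qed.

(** The masses [q1], [q2], [q3] of the three steps on [A] solve a nonsingular linear system: they
    add up to the mass of [A], the imaginary part gives [q2 = q3], and the real part gives
    [q1 = (q2 + q3) / 2]. *)
Lemma martingale_step_uniform (W S : T -> int * int) (A : set T) s :
  discretely_measurable (@measurable _ T) S -> (forall x, S x \in steps) ->
  measurable A ->
  P.-integrable setT (fun x => (complex.Re (eis R (W x)))%:E) ->
  P.-integrable setT (fun x => (complex.Im (eis R (W x)))%:E) ->
  (\int[P]_(x in A) (complex.Re (eis R (W x)))%:E =
   \int[P]_(x in A) (complex.Re (eis R (W x + S x)))%:E)%E ->
  (\int[P]_(x in A) (complex.Im (eis R (W x)))%:E =
   \int[P]_(x in A) (complex.Im (eis R (W x + S x)))%:E)%E ->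
  s \in steps -> fine (P (A `&` [set x | S x = s])) = fine (P A) / 3.
Proof.
move=> mS Ssteps mA iRe iIm eqRe eqIm.
have mSs s' : measurable [set x | S x = s'] by exact: (mS [set s']).
have tot : fine (P A) = \sum_(s <- steps) fine (P (A `&` [set x | S x = s])).
  rewrite -{1}(setIT A); apply: fine_measure_partition => // x _.
  rewrite indicT -(@sum_indic_fibers R T _ steps S (fun=> 1) x) //.
  by under eq_bigr do rewrite mul1r.
have ReD : {morph (fun w => complex.Re (eis R w)) : w s / w + s}.
  by move=> v u; rewrite eisD; case: (eis R v) (eis R u) => ? ? [].
have ImD : {morph (fun w => complex.Im (eis R w)) : w s / w + s}.
  by move=> v u; rewrite eisD; case: (eis R v) (eis R u) => ? ? [].
have := conserved_mean_step mS Ssteps mA ReD iRe eqRe.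
have := conserved_mean_step mS Ssteps mA ImD iIm eqIm.
move: tot; rewrite !big_cons !big_nil !eisE /= !addr0.
set p := fine _; set q1 := fine _; set q2 := fine _; set q3 := fine _.
have s0 : 0 < Num.sqrt 3 :> R by rewrite sqrtr_gt0.
rewrite !inE => tot im re.
have q23 : q2 = q3.
  have : (Num.sqrt 3 / 2) * (q2 - q3) = 0 by rewrite -[RHS]im; ring.
  by move=> /eqP; rewrite mulf_eq0 subr_eq0 gt_eqF ?divr_gt0//= => /eqP.
have q12 : q1 = q2 by move: re; rewrite -q23; lra.
by case/or3P => /eqP->; rewrite -/q1 -/q2 -/q3; lra.
Qed.

(** Given the position, exactly one of the three equally likely steps produces [c]. *)
Lemma walk_incr_uniform (G : set (set T)) (W S : T -> int * int) (A : set T) c :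
  sigma_algebra setT G -> G `<=` measurable ->
  discretely_measurable G W ->
  discretely_measurable (@measurable _ T) S -> (forall x, S x \in steps) ->
  (forall A s, G A -> s \in steps ->
    fine (P (A `&` [set x | S x = s])) = fine (P A) / 3) ->
  G A -> c \in [:: 1; 0; -1] ->
  fine (P (A `&` [set x | walk_incr (W x) (S x) = c])) = fine (P A) / 3.
Proof.
move=> sG Gm GW mS Ssteps GS GA cin.
pose E s := [set x | walk_incr (W x) s = c].
have GE s : G (E s) by exact: (GW [set w | walk_incr w s = c]).
have mE s : measurable (E s) by exact: Gm.
have mA := Gm _ GA.
have mSs s : measurable [set x | S x = s] by exact: (mS [set s]).
(* Once the step is fixed to [s], the condition on the increment involves the position alone and
   becomes the event [E s] of [G]. *)
have incrE x : \1_[set x | walk_incr (W x) (S x) = c] x =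
    \sum_(s <- steps) \1_(E s `&` [set y | S y = s]) x :> R.
  rewrite indicE; under eq_bigr do rewrite indicI/= .
  by rewrite sum_indic_fibers// indicE; congr (_%:R).
rewrite (@fine_measure_partition _ _ _ P _ steps
  (fun s => E s `&` [set y | S y = s])) //; last 2 first.
- by move=> s; exact: measurableI.
- have mW : discretely_measurable (@measurable _ T) W.
    by move=> B; apply: Gm; exact: GW.
  exact: (discretely_measurable_pair (@sigma_algebra_measurable _ T) mW mS
    [set v | walk_incr v.1 v.2 = c]).
transitivity (\sum_(s <- steps) fine (P (A `&` E s)) / 3).
  apply: eq_big_seq => s sin; rewrite setIA GS//; exact: sigma_algebra_setI.
rewrite -mulr_suml.
rewrite -(@fine_measure_partition _ _ _ P _ steps E A setT) ?setIT// => x _.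
rewrite indicT.
(* Pointwise, the sum counts the steps that produce [c] from [W x]; by [walk_incr_perm] there is
   exactly one. *)
transitivity (\sum_(v <- [seq walk_incr (W x) s | s <- steps]) (v == c)%:R : R);
  last first.
  rewrite big_map; apply: eq_bigr => s _.
  rewrite indicE; congr ((nat_of_bool _)%:R).
  by apply/idP/idP => [/eqP /mem_set//|/set_mem/= ->].
rewrite (perm_big _ (walk_incr_perm (W x))) /= !big_cons big_nil /=.
by move: cin; rewrite !inE => /or3P[] /eqP-> /=; rewrite ?add0r ?addr0.
Qed.

End Steps.

(** * Assembly of the simple walk *)

Lemma measurable_set1_pair (R : realType) (z : R * R) : measurable [set z].
Proof.
case: z => a b; rewrite (_ : [set _] = [set a] `*` [set b]).
  exact: measurableX.
by apply/seteqP; split => [x /= ->//|[x y] /= [-> ->]].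
Qed.

Theorem theorem1 (R : realType) (d : measure_display) (T : measurableType d)
  (P : probability T R) (tau : nat -> T -> R[i]) (htau : iid_steps P tau)
  (Z : nat -> T -> R[i]) (hZ : parisian_walk P (filtration_of tau) Z) :
  simple_walk P (filtration_of tau)
    (fun t x => (Pdist (Z t x))%:R - (local_time (fun u => Z u x) t)%:R).
Proof.
have [mtau _ _] := htau.
have [Zad [[_ iRe cRe] [_ iIm cIm]] [z0 /eisP[w0 ->{z0}] Z0] Zstep] := hZ.
set F := filtration_of tau in Zad iRe cRe iIm cIm *.
have sF t : sigma_algebra setT (F t) := @filtration_sigma_algebra _ _ _ _ t.
have Fm t : F t `<=` measurable by exact: filtration_measurable.
have FS t : F t `<=` F t.+1 by exact: filtration_le.
have stepE t x : exists2 s, s \in steps & Z t.+1 x = Z t x + eis R s.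
  have := Zstep t x.
  have -> : [:: 1; zeta; zeta ^+ 2] = [seq eis R s | s <- steps].
    by rewrite /steps /= /eis /= zeta2E; congr [:: _; _; _]; ring.
  by move=> /mapP[s sin e]; exists s => //; rewrite -e addrC subrK.
have Zlattice t x : exists w, Z t x = eis R w.
  elim: t x => [|t IH] x; first by exists w0.
  have [s _ ->] := stepE t x; have [w ->] := IH x.
  by exists (w + s); rewrite eisD.
(* Coordinates are chosen pointwise; [FW] recovers their measurability, since [eis] is injective and
   the fibres of [W t] are thus preimages of points under [Z t]. *)
have [W WE] : exists W, forall t x, Z t x = eis R (W t x).
  have [W' W'E] := choice (fun tx : nat * T => Zlattice tx.1 tx.2).
  by exists (fun t x => W' (t, x)) => t x; rewrite (W'E (t, x)).
pose S t x := W t.+1 x - W t x.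
have WS t x : W t.+1 x = W t x + S t x by rewrite /S addrC subrK.
have Ssteps t x : S t x \in steps.
  have [s sin] := stepE t x; rewrite !WE -eisD => /eis_inj.
  by rewrite WS => /addrI ->.
have FW t : discretely_measurable (F t) (W t).
  apply: discretely_measurable_fibers => // w.
  rewrite (_ : _ @^-1` _ = (fun x => ReIm (Z t x)) @^-1` [set ReIm (eis R w)]).
    by apply: Zad; exact: measurable_set1_pair.
  apply/seteqP; split => x /=; rewrite WE; first by move=> ->.
  case eW : (eis R (W t x)) => [a b]; case ew : (eis R w) => [a' b'] [aa bb].
  by apply: (@eis_inj R); rewrite eW ew aa bb.
have FWS t : discretely_measurable (F t.+1) (fun x => (W t x, S t x)).
  have GW : discretely_measurable (F t.+1) (W t).
    by move=> B; apply: FS; exact: FW.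
  (* The pair is a function of [W t] and [W t.+1], both measurable for [F t.+1]. *)
  move=> B; exact: (discretely_measurable_pair (sF t.+1) GW (FW t.+1)
    [set u | B (u.1, u.2 - u.1)]).
have mS t : discretely_measurable (@measurable _ T) (S t).
  by move=> B; exact: (Fm _ _ (FWS t [set u | B u.2])).
have Suniform t A s : F t A -> s \in steps ->
    fine (P (A `&` [set x | S t x = s])) = fine (P A) / 3.
  move=> FA.
  have [_ _ /(_ _ FA) eRe] := cRe t; have [_ _ /(_ _ FA) eIm] := cIm t.
  have Rint f t' : (fun x => (f (Z t' x))%:E : \bar R) =
      (fun x => (f (eis R (W t' x)))%:E).
    by apply/funext => x; rewrite WE.
  have iRe' := iRe t; have iIm' := iIm t.
  rewrite /comp /= Rint in iRe'; rewrite /comp /= Rint in iIm'.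
  apply: (@martingale_step_uniform _ _ _ _ (W t)) => //.
  - exact: (Fm _ _ FA).
  - under eq_integral do rewrite -WE.
    by rewrite eRe; apply: eq_integral => x _; rewrite WE WS.
  - under eq_integral do rewrite -WE.
    by rewrite eIm; apply: eq_integral => x _; rewrite WE WS.
pose D t x := walk_incr (W t x) (S t x).
(* Integer-valued form of the process, to which [discretely_measurable] applies. *)
pose N t x := (Pdist (Z t x))%:Z - (local_time (fun u => Z u x) t)%:Z.
have NE t x : (Pdist (Z t x))%:R - (local_time (fun u => Z u x) t)%:R =
    (N t x)%:~R :> R.
  by rewrite /N rmorphB.
under [X in simple_walk _ _ X]eq2_fun do rewrite NE.
have NS t x : N t.+1 x = N t x + D t x.
  by rewrite /N (@walk_incrE R (fun u => Z u x) t (W t x) (S t x)) ?WE ?WS.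
have N0 x : N 0%N x = hexdist w0.
  rewrite /N Z0 Pdist_eis /local_time /exits !eq_card0 ?subr0 //; by case.
(* Induction on [t]: the start is constant, and [N t.+1] is a function of [N t], [W t] and [S t]. *)
have FN t : discretely_measurable (F t) (N t).
  elim: t => [|t IH].
    have [G0 GC _] := sF 0%N.
    have GT : F 0%N setT by rewrite -(setD0 setT); exact: GC.
    move=> B; have [BN|BN] := pselect (B (hexdist w0)).
      rewrite (_ : _ @^-1` _ = setT) //.
      by apply/seteqP; split => x //= _; rewrite N0.
    rewrite (_ : _ @^-1` _ = set0) //.
    by apply/seteqP; split => x //=; rewrite N0.
  have GN : discretely_measurable (F t.+1) (N t).
    by move=> B; apply: FS; exact: IH.
  move=> B; rewrite (_ : _ @^-1` _ = (fun x => (N t x, (W t x, S t x))) @^-1`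
      [set u | B (u.1 + walk_incr u.2.1 u.2.2)]).
    exact: (discretely_measurable_pair (sF t.+1) GN (FWS t)).
  by apply/seteqP; split => x /=; rewrite NS.
pose vals : seq int := [:: 1; 0; -1].
have Dvals t x : D t x \in vals.
  rewrite -(perm_mem (walk_incr_perm (W t x))).
  exact: (map_f (walk_incr (W t x)) (Ssteps t x)).
have mD t c : measurable [set x | D t x = c].
  exact: (Fm _ _ (FWS t [set u | walk_incr u.1 u.2 = c])).
have Duniform t A c : F t A -> c \in vals ->
    fine (P (A `&` [set x | D t x = c])) = fine (P A) / 3.
  by move=> FA cin; apply: (walk_incr_uniform (sF t)) => //; exact: Suniform.
have NSR t x : (N t.+1 x)%:~R =
    (N t x)%:~R + \sum_(c <- vals) c%:~R * \1_[set y | D t y = c] x :> R.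
  rewrite NS rmorphD /=.
  by rewrite (@sum_indic_fibers R T _ vals (D t) (fun c => c%:~R)).
have Nint t : P.-integrable setT (fun x => ((N t x)%:~R : R)%:E).
  elim: t => [|t IH].
    by under eq_fun do rewrite N0; apply: finite_measure_integrable_cst.
  under eq_fun do rewrite NSR EFinD.
  by apply: integrableD => //; exact: integrable_simple.
have NF t (B : set R) : F t ((fun x => (N t x)%:~R) @^-1` B).
  exact: (FN t [set k | B k%:~R]).
split.
- split => [t B _|t|t]; [exact: NF|exact: Nint|].
  split => [B _||A FA]; [exact: NF|exact: Nint|].
  rewrite (integral_add_simple (mD t) (Fm _ _ FA) (Nint t) (NSR t))//.
  (* The drift over [A] is [1 + 0 - 1] times a third of the mass of [A]. *)
  rewrite (_ : \sum_(i <- _) _ = 0) ?adde0//.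
  rewrite (eq_big_seq (fun c : int => c%:~R * (fine (P A) / 3))); last first.
    by move=> c cin; rewrite Duniform.
  by rewrite -mulr_suml !big_cons big_nil /=; ring.
- by exists (hexdist w0) => x; rewrite N0.
(* The unconditional law of the increment is [Duniform] with [A = setT]. *)
- move=> t; have DE c : c \in vals ->
      P [set x | (N t.+1 x)%:~R - (N t x)%:~R = c%:~R :> R] = (3^-1)%:E.
    move=> cin; have [G0 GC _] := sF t.
    have GT : F t setT by rewrite -(setD0 setT); exact: GC.
    have := Duniform t _ _ GT cin.
    rewrite setTI probability_setT /= mul1r => <-.
    rewrite fineK ?fin_num_measure//; congr (P _).
    apply/seteqP; split => x /=; rewrite NS rmorphD addrAC subrr add0r.
      by move/intr_inj.
    by move=> ->.
  by split; [apply: (DE 1)|apply: (DE 0)|apply: (DE (-1))].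
Qed.
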